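(* Let $(A,\ast,\Phi=\{\partial_1,\partial_2\})$ be a differential Zinbiel algebra. Define a bilinear multiplication $\diamond\colon A\otimes A\to A$ by $$a\diamond b:=\partial_1(a)\ast\partial_2(b)-\partial_2(a)\ast\partial_1(b),\qquad a,b\in A.$$ Then $(A,\diamond,\ast)$ is a pre-Poisson algebra.
   Context: All vector spaces are finite-dimensional over a field $\mathbb F$ of characteristic $0$. (Left) Zinbiel algebra $(A,\ast)$: a vector space with a bilinear operation satisfying $a\ast(b\ast c)=(a\ast b)\ast c+(b\ast a)\ast c$. Differential Zinbiel algebra $(A,\ast,\Phi=\{\partial_1,\partial_2\})$: a Zinbiel algebra with commuting linear maps $\partial_1,\partial_2\colon A\to A$ satisfying $\partial_k(a\ast b)=\partial_k(a)\ast b+a\ast\partial_k(b)$. (Left) pre-Lie algebra $(A,\diamond)$: $a\diamond(b\diamond c)-(a\diamond b)\diamond c=b\diamond(a\diamond c)-(b\diamond a)\diamond c$. (Left) pre-Poisson algebra $(A,\diamond,\ast)$: $(A,\diamond)$ is a pre-Lie algebra, $(A,\ast)$ is a Zinbiel algebra, and for all $a,b,c\in A$: $(a\diamond b-b\diamond a)\ast c=a\diamond(b\ast c)-b\ast(a\diamond c)$ and $(a\ast b+b\ast a)\diamond c=a\ast(b\diamond c)+b\ast(a\diamond c)$. *)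

(* Defs.v *)
From HB Require Import structures.
From mathcomp Require Import all_boot all_order all_algebra.

Set Implicit Arguments.
Unset Strict Implicit.
Unset Printing Implicit Defensive.

Import GRing.Theory.
Local Open Scope ring_scope.

Section Algebras.
Variables (F : fieldType) (A : vectType F).
Implicit Types (op star dia : A -> A -> A) (d : A -> A).

Definition bilinear_op op : Prop := bilinear_for *:%R *:%R op.

Record is_zinbiel star : Prop := IsZinbiel {
  zinbiel_bilinear : bilinear_op star;
  zinbiel_identity : forall a b c,
    star a (star b c) = star (star a b) c + star (star b a) c
}.

Record is_pre_lie dia : Prop := IsPreLie {
  pre_lie_bilinear : bilinear_op dia;
  pre_lie_identity : forall a b c,
    dia a (dia b c) - dia (dia a b) c = dia b (dia a c) - dia (dia b a) c
}.

Definition is_derivation op d : Prop :=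
  linear d /\ forall a b, d (op a b) = op (d a) b + op a (d b).

Record is_diff_zinbiel star (d1 d2 : A -> A) : Prop := IsDiffZinbiel {
  diff_zinbiel_zinbiel : is_zinbiel star;
  diff_zinbiel_derivation1 : is_derivation star d1;
  diff_zinbiel_derivation2 : is_derivation star d2;
  diff_zinbiel_comm : forall a, d1 (d2 a) = d2 (d1 a)
}.

Record is_pre_poisson dia star : Prop := IsPrePoisson {
  pre_poisson_pre_lie : is_pre_lie dia;
  pre_poisson_zinbiel : is_zinbiel star;
  pre_poisson_commutator : forall a b c,
    star (dia a b - dia b a) c = dia a (star b c) - star b (dia a c);
  pre_poisson_anticommutator : forall a b c,
    dia (star a b + star b a) c = star a (dia b c) + star b (dia a c)
}.

Definition diamond star (d1 d2 : A -> A) (a b : A) : A :=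
  star (d1 a) (d2 b) - star (d2 a) (d1 b).

End Algebras.

(* Main.v *)
Require Import Defs.
From mathcomp Require Import all_boot all_order all_algebra.
Import GRing.Theory.
Local Open Scope ring_scope.

(** In a Zinbiel algebra put [{a, b} = a * b + b * a]. The Zinbiel identity says
    that the left multiplications [L_a : c |-> a * c] satisfy
    [L_a L_b = L_{a, b}]; since [{a, b}] is symmetric, they commute. Hence left
    multiplication represents the commutative associative algebra
    [(A, {_, _})], and [a <> _ = L_(d1 a) d2 - L_(d2 a) d1] is the Hamiltonian
    operator of [a]. The commutator [[a, b] = a <> b - b <> a] is the Jacobian
    Poisson bracket of that commutative algebra, so that
    [L_[a, b] = L_(d1 a) L_(d2 b) - L_(d2 a) L_(d1 b)] ([star_commutator]).

    The two compatibility conditions follow from this formula, the Leibniz rule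
    for [d1] and [d2], and the commutation of left multiplications. The first
    of them reads [a <> (b * c) = [a, b] * c + b * (a <> c)]. Applying it to the
    two terms of [a <> (b <> c)] gives [[a, d1 b] * d2 c - [a, d2 b] * d1 c] and
    a term of second order in [c] ([diamond_diamond]), which is symmetric in [a]
    and [b] ([second_order_sym]). Antisymmetrizing in [a] and [b] thus leaves
    [([d1 a, b] + [a, d1 b]) * d2 c - ([d2 a, b] + [a, d2 b]) * d1 c]. As [d1]
    and [d2] commute, both are derivations of [<>] ([diamond_derivation]), hence
    of the commutator, and what is left is [[a, b] <> c]: the pre-Lie
    identity. *)

Section DiamondProduct.

Variables (F : fieldType) (A : vectType F).
Variables (star : A -> A -> A) (d1 d2 : A -> A).
Hypothesis HA : is_diff_zinbiel star d1 d2.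

Local Notation "a * b" := (star a b) : ring_scope.
Local Notation dia := (diamond star d1 d2).
Local Notation comm a b := (dia a b - dia b a).

Lemma star_linearl c : linear (star^~ c).
Proof. by case: HA => -[[]]. Qed.

Lemma star_linearr c : linear (star c).
Proof. by case: HA => -[[]]. Qed.

Lemma d1_linear : linear d1. Proof. by case: HA => _ []. Qed.

Lemma d2_linear : linear d2. Proof. by case: HA => _ _ []. Qed.

Lemma linear_add (f : A -> A) : linear f -> {morph f : a b / a + b}.
Proof. by move=> f_lin a b; rewrite -[a]scale1r f_lin !scale1r. Qed.

Lemma starBl a b c : (a - b) * c = a * c - b * c.
Proof. exact: (zmod_morphism_linear (star_linearl c)). Qed.

Lemma starDl a b c : (a + b) * c = a * c + b * c.
Proof. exact: (linear_add _ (star_linearl c)). Qed.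

Lemma starBr a b c : a * (b - c) = a * b - a * c.
Proof. exact: (zmod_morphism_linear (star_linearr a)). Qed.

Lemma starDr a b c : a * (b + c) = a * b + a * c.
Proof. exact: (linear_add _ (star_linearr a)). Qed.

Lemma d1D : {morph d1 : a b / a + b}. Proof. exact: linear_add _ d1_linear. Qed.

Lemma d2D : {morph d2 : a b / a + b}. Proof. exact: linear_add _ d2_linear. Qed.

Lemma d1B : {morph d1 : a b / a - b}. Proof. exact: zmod_morphism_linear d1_linear. Qed.

Lemma d2B : {morph d2 : a b / a - b}. Proof. exact: zmod_morphism_linear d2_linear. Qed.

Lemma d1M a b : d1 (a * b) = d1 a * b + a * d1 b.
Proof. by case: HA => _ []. Qed.

Lemma d2M a b : d2 (a * b) = d2 a * b + a * d2 b.
Proof. by case: HA => _ _ []. Qed.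

Lemma d12C a : d1 (d2 a) = d2 (d1 a).
Proof. by case: HA. Qed.

Lemma star_sym_prod a b c : (a * b + b * a) * c = a * (b * c).
Proof. by case: HA => -[_ ->]; rewrite starDl. Qed.

Lemma star_left_comm a b c : a * (b * c) = b * (a * c).
Proof. by rewrite -!star_sym_prod [b * a + _]addrC. Qed.

Lemma diamond_linearl c : linear (dia^~ c).
Proof.
move=> k a b; rewrite /diamond d1_linear d2_linear.
by rewrite !star_linearl scalerBr opprD addrACA.
Qed.

Lemma diamond_linearr c : linear (dia c).
Proof.
move=> k a b; rewrite /diamond d1_linear d2_linear.
by rewrite !star_linearr scalerBr opprD addrACA.
Qed.

Lemma diamondBr a b c : dia a (b - c) = dia a b - dia a c.
Proof. exact: (zmod_morphism_linear (diamond_linearr a)). Qed.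

Lemma diamondBl a b c : dia (a - b) c = dia a c - dia b c.
Proof. exact: (zmod_morphism_linear (diamond_linearl c)). Qed.

(** The commutator acts through [{d1 a, d2 b} - {d2 a, d1 b}], the Jacobian of
    [a] and [b] for the symmetrized product. *)
Lemma star_commutator a b c :
  comm a b * c = d1 a * (d2 b * c) - d2 a * (d1 b * c).
Proof.
rewrite -!star_sym_prod -starBl; congr (_ * c).
by rewrite /diamond opprB addrACA opprD.
Qed.

Lemma commutator_star a b c : comm a b * c = dia a (b * c) - b * dia a c.
Proof.
rewrite star_commutator /diamond d1M d2M starBr !starDr.
rewrite (star_left_comm b (d1 a)) (star_left_comm b (d2 a)).
by rewrite opprD addrACA addrK.
Qed.

Lemma diamond_star a b c : dia a (b * c) = comm a b * c + b * dia a c.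
Proof. by rewrite commutator_star subrK. Qed.

Lemma anticommutator_diamond a b c :
  dia (a * b + b * a) c = a * dia b c + b * dia a c.
Proof.
have der d : {morph d : x y / x + y} ->
    (forall x y, d (x * y) = d x * y + x * d y) ->
    forall z, d (a * b + b * a) * z = a * (d b * z) + b * (d a * z).
  move=> dD dM z; rewrite dD !dM -!star_sym_prod -starDl; congr (_ * z).
  by rewrite [d a * b + _]addrC addrACA [d a * b + _]addrC.
rewrite /diamond (der _ d1D d1M) (der _ d2D d2M) !starBr.
by rewrite opprD addrACA.
Qed.

(** Both [d1] and [d2] are instances: any derivation of [*] that commutes with
    [d1] and [d2] is a derivation of [<>]. *)
Lemma diamond_derivation d : {morph d : a b / a - b} ->
    (forall a b, d (a * b) = d a * b + a * d b) ->
    (forall a, d (d1 a) = d1 (d a)) -> (forall a, d (d2 a) = d2 (d a)) ->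
  forall a b, d (dia a b) = dia (d a) b + dia a (d b).
Proof.
move=> dB dM dd1 dd2 a b.
by rewrite /diamond dB !dM !dd1 !dd2 opprD addrACA.
Qed.

Lemma d1_diamond a b : d1 (dia a b) = dia (d1 a) b + dia a (d1 b).
Proof. exact: diamond_derivation d1B d1M _ d12C _ _. Qed.

Lemma d2_diamond a b : d2 (dia a b) = dia (d2 a) b + dia a (d2 b).
Proof. by apply: diamond_derivation d2B d2M _ _ _ _ => // x; rewrite d12C. Qed.

Lemma d1_commutator a b : d1 (comm a b) = comm (d1 a) b + comm a (d1 b).
Proof. by rewrite d1B !d1_diamond [dia (d1 b) a + _]addrC opprD addrACA. Qed.

Lemma d2_commutator a b : d2 (comm a b) = comm (d2 a) b + comm a (d2 b).
Proof. by rewrite d2B !d2_diamond [dia (d2 b) a + _]addrC opprD addrACA. Qed.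

(** The part of [a <> (b <> c)] in which [c] is differentiated twice. *)
Definition second_order a b c := d1 b * dia a (d2 c) - d2 b * dia a (d1 c).

Lemma diamond_diamond a b c :
  dia a (dia b c) =
  comm a (d1 b) * d2 c - comm a (d2 b) * d1 c + second_order a b c.
Proof. by rewrite [dia b c]/diamond diamondBr !diamond_star (opprD (_ * d1 c)) addrACA. Qed.

(** Expanding gives [L_(d1 a) L_(d1 b) d2^2 + L_(d2 a) L_(d2 b) d1^2] minus the
    two mixed terms, which the exchange of [a] and [b] swaps; this needs [d1]
    and [d2] to commute on [c]. *)
Lemma second_order_sym a b c : second_order a b c = second_order b a c.
Proof.
rewrite /second_order /diamond !starBr d12C !opprB.
rewrite !(star_left_comm (d1 b)) !(star_left_comm (d2 b)).
by rewrite addrACA [- _ - _]addrC addrACA.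
Qed.

Lemma commutator_diamond a b c :
  dia (comm a b) c = dia a (dia b c) - dia b (dia a c).
Proof.
have comm_anti x y z : comm x y * z = - (comm y x * z).
  by rewrite (starBl (dia x y)) (starBl (dia y x)) opprB.
rewrite !diamond_diamond (second_order_sym b) [X in _ = _ - X]addrC addrKA.
rewrite {1}/diamond d1_commutator d2_commutator.
rewrite (starDl (comm (d1 a) b)) (starDl (comm (d2 a) b)).
rewrite (comm_anti (d1 a)) (comm_anti (d2 a)).
move: (comm a (d1 b) * d2 c) (comm a (d2 b) * d1 c) => p q.
move: (comm b (d1 a) * d2 c) (comm b (d2 a) * d1 c) => r s.
rewrite [- r + p]addrC [- s + q]addrC !opprB.
by rewrite addrACA [RHS]addrACA [- r - q]addrC.
Qed.

Lemma diamond_pre_lie : is_pre_lie dia.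
Proof.
split=> [|a b c].
  by split; [exact: diamond_linearl | exact: diamond_linearr].
have := commutator_diamond a b c; rewrite diamondBl => uv.
apply/eqP; rewrite subr_eq -addrA [- _ + _]addrC uv.
by rewrite [_ + (_ - _)]addrC subrK.
Qed.

End DiamondProduct.

Theorem proposition5p48 (F : fieldType) (charF0 : [pchar F] =i pred0)
    (A : vectType F) (star : A -> A -> A) (d1 d2 : A -> A)
    (HA : is_diff_zinbiel star d1 d2) :
  is_pre_poisson (diamond star d1 d2) star.
Proof.
split.
- exact: diamond_pre_lie.
- by case: HA.
- exact: commutator_star.
- exact: anticommutator_diamond.
Qed.
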